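(* Let $X$ be a non-degenerate real-valued random variable, let $\Phi$ be a convex real-valued function on some interval that contains the range of $X$, and let $I\subseteq\mathbb{R}$ be an open interval such that for all $\theta\in I$, $$\mathbf{E}(e^{\theta X})<\infty,\qquad \mathbf{E}\bigl(X^2\,|\Phi(X)|\,e^{\theta X}\bigr)<\infty ,$$ and $\mathbf{E}\bigl(|\Phi(X)|e^{\theta X}\bigr)<\infty$. Then the function $\varrho\mapsto \mathbf{E}^{\theta(\varrho)}\Phi(X)$ is convex on $J$.
   Context: Non-degenerate means that the distribution of $X$ is not concentrated on a single point. For $\theta\in I$ the exponentially weighted expectation is $\mathbf{E}^\theta(Y):=\mathbf{E}(Y e^{\theta X})/\mathbf{E}(e^{\theta X})$. Put $\varrho(\theta):=\mathbf{E}^\theta X$ for $\theta\in I$; this function is strictly increasing and continuous on $I$, $J:=\varrho(I)$ is a nontrivial open interval, and $\theta(\varrho)$, $\varrho\in J$, denotes the inverse function. *)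

(* Defs.v *)
From HB Require Import structures.
From mathcomp Require Import all_boot all_order all_algebra.
From mathcomp Require Import all_classical all_reals all_analysis.

Set Implicit Arguments.
Unset Strict Implicit.
Unset Printing Implicit Defensive.

Import Order.TTheory GRing.Theory Num.Theory.
Import numFieldNormedType.Exports.

Local Open Scope classical_set_scope.
Local Open Scope ring_scope.

Definition nondegenerate_rv d (T : measurableType d) (R : realType)
    (P : probability T R) (X : {RV P >-> R}) : Prop :=
  ~ exists c : R, distribution P X [set c] = 1%E.
Arguments nondegenerate_rv {d T R} P X.

(* [fine] makes the value real; it is meaningful only when both expectations
   are finite. *)
Definition tilted_expectation d (T : measurableType d) (R : realType)
    (P : probability T R) (X : {RV P >-> R}) (theta : R) (Y : T -> R) : R :=
  fine 'E_P[fun w => Y w * expR (theta * X w)]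
  / fine 'E_P[fun w => expR (theta * X w)].
Arguments tilted_expectation {d T R} P X theta Y.

Definition tilted_mean d (T : measurableType d) (R : realType)
    (P : probability T R) (X : {RV P >-> R}) (theta : R) : R :=
  tilted_expectation P X theta X.
Arguments tilted_mean {d T R} P X theta.

(* [pinv] is the inverse on the image [tilted_mean P X @` I]; the restriction of
   [tilted_mean P X] to [I] is injective when [X] is nondegenerate and the
   exponential moments are finite on the open interval [I]. *)
Definition tilted_mean_inv d (T : measurableType d) (R : realType)
    (P : probability T R) (X : {RV P >-> R}) (I : set R) : R -> R :=
  pinv I (tilted_mean P X).
Arguments tilted_mean_inv {d T R} P X I _.

(* Main.v *)
Require Import Defs.
From HB Require Import structures.
From mathcomp Require Import all_boot all_order all_algebra.
From mathcomp Require Import all_classical all_reals all_analysis.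
From mathcomp Require Import measurable_realfun ring lra.

(* Given rho_1 = s rho_0 + (1 - s) rho_2 in J with rho_i the tilted mean at
   theta_i, put
     w(x) = s e^(theta_0 x) / Z_0 + (1 - s) e^(theta_2 x) / Z_2
            - e^(theta_1 x) / Z_1,   Z_i = E e^(theta_i X).
   Then E w(X) = E X w(X) = 0, the claim is E Phi(X) w(X) >= 0, and [w < 0] is an
   open interval because w e^(-theta_1 x) is convex.  If L is the chord of Phi over
   [w < 0], then (Phi - L) w >= 0 on D by convexity, and E L(X) w(X) = 0.  If
   [w < 0] is empty or has an end outside D, there is no chord, but some nonzero
   affine l satisfies l w >= 0 on D; then l(X) w(X) = 0 almost surely, hence
   E Phi(X) w(X) = 0.  That rho_1 lies in J follows from the continuity of the
   tilted mean. *)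

Set Implicit Arguments.
Unset Strict Implicit.
Unset Printing Implicit Defensive.

Import Order.TTheory GRing.Theory Num.Theory.
Import numFieldNormedType.Exports.

Local Open Scope classical_set_scope.
Local Open Scope ring_scope.

(** * Convex functions and open intervals on the real line *)

(** Clearing the denominator [z - x] keeps the case [x = z] and makes the inequality linear in the
    values of [f]. *)
Lemma convex_function_chord (R : realType) (D : set R) (f : R -> R)
    (x y z : R) :
  convex_function (E := R^o) D f -> D x -> D z -> x <= y <= z ->
  (z - x) * f y <= (z - y) * f x + (y - x) * f z.
Proof.
move=> cf Dx Dz /andP[xy yz].
have [xz|zx] := ltP x z; last first.
  have zy : z = y by apply/eqP; rewrite eq_le yz (le_trans zx xy).
  have xy' : x = y by apply/eqP; rewrite eq_le xy (le_trans yz zx).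
  by rewrite zy xy' !subrr !mul0r addr0.
have zx0 : 0 < z - x by rewrite subr_gt0.
have zxN0 : z - x != 0 by rewrite gt_eqF.
pose t := (z - y) / (z - x).
have t0 : 0 <= t by rewrite divr_ge0 ?subr_ge0// ltW.
have t1 : t <= 1 by rewrite ler_pdivrMr// mul1r lerB.
have : f (t * x + (1 - t) * z) <= t * f x + (1 - t) * f z.
  exact: (cf (Itv01 t0 t1) x z (mem_set Dx) (mem_set Dz)).
have -> : t * x + (1 - t) * z = y by rewrite /t; field.
move=> H; have := ler_wpM2l (ltW zx0) H.
suff -> : (z - x) * (t * f x + (1 - t) * f z) =
  (z - y) * f x + (y - x) * f z by [].
by rewrite /t; field.
Qed.

(** The set carries [D x] because nothing is known about [f] outside [D]. It serves both the
    measurability of [Phi \o X] and the interval [[w < 0]]. *)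
Lemma is_interval_convex_sublevel (R : realType) (D : set R) (f : R -> R)
    (c : R) :
  is_interval D -> convex_function (E := R^o) D f ->
  is_interval [set x | D x /\ f x < c].
Proof.
move=> iD cf x z [Dx fx] [Dz fz] y /andP[xy yz].
split; first by apply: (iD x z) => //; rewrite xy.
have [xz|zx] := ltP x z; last first.
  by have -> : y = x by apply/eqP; rewrite eq_le xy (le_trans yz zx).
rewrite -(ltr_pM2l (_ : 0 < z - x)) ?subr_gt0//.
have /le_lt_trans : (z - x) * f y <= (z - y) * f x + (y - x) * f z.
  by apply: (convex_function_chord cf) => //; rewrite xy.
apply; rewrite (_ : (z - x) * c = (z - y) * c + (y - x) * c); last by ring.
have [yltz|zy] := ltP y z.
  by rewrite ltr_leD ?ltr_pM2l ?subr_gt0// ler_wpM2l ?subr_ge0// ltW.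
rewrite ler_ltD ?ltr_pM2l ?subr_gt0 ?ler_wpM2l ?subr_ge0 ?(lt_le_trans xz)//.
exact: ltW.
Qed.

(** The end is [inf N]: [l] bounds [N] below because the interval [N] contains [n] but not [l], and
    openness makes [u < n] strict. *)
Lemma open_interval_left_end (R : realType) (N : set R) (l n : R) :
  is_interval N -> open N -> N n -> ~ N l -> l < n ->
  exists u, [/\ l <= u, u < n, forall x, x < u -> ~ N x &
                forall x, u < x -> x <= n -> N x].
Proof.
move=> iN oN Nn Nl ln.
have lbN : lbound N l.
  move=> x Nx; rewrite leNgt; apply/negP => xl.
  by apply: Nl; apply: (iN x n) => //; rewrite !ltW.
have hlN : has_lbound N by exists l.
have neN : N !=set0 by exists n.
exists (inf N); split.
- exact: lb_le_inf.
- have /nbhs_ballP[e /= e0 eN] : nbhs n N by exact: open_nbhs_nbhs.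
  have : N (n - e / 2).
    apply: eN; rewrite /ball/= opprB addrC subrK gtr0_norm ?divr_gt0//.
    by rewrite ltr_pdivrMr// ltr_pMr// ltr1n.
  by move=> /(ge_inf hlN) /le_lt_trans; apply; rewrite ltrBlDr ltrDl divr_gt0.
- by move=> x xu /(ge_inf hlN); rewrite leNgt xu.
- move=> x ux xn; have [m Nm mx] := inf_lt neN ux.
  by apply: (iN m n) => //; rewrite (ltW mx) xn.
Qed.

Lemma open_interval_right_end (R : realType) (N : set R) (n r : R) :
  is_interval N -> open N -> N n -> ~ N r -> n < r ->
  exists v, [/\ v <= r, n < v, forall x, v < x -> ~ N x &
                forall x, n <= x -> x < v -> N x].
Proof.
move=> iN oN Nn Nr nr.
have ubN : ubound N r.
  move=> x Nx; rewrite leNgt; apply/negP => rx.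
  by apply: Nr; apply: (iN n x) => //; rewrite !ltW.
have huN : has_ubound N by exists r.
have neN : N !=set0 by exists n.
exists (sup N); split.
- exact: ge_sup.
- have /nbhs_ballP[e /= e0 eN] : nbhs n N by exact: open_nbhs_nbhs.
  have : N (n + e / 2).
    apply: eN; rewrite /ball/= opprD addNKr normrN gtr0_norm ?divr_gt0//.
    by rewrite ltr_pdivrMr// ltr_pMr// ltr1n.
  by move=> /(ub_le_sup huN); apply: lt_le_trans; rewrite ltrDl divr_gt0.
- by move=> x xu /(ub_le_sup huN); rewrite leNgt xu.
- move=> x nx xv; have [m Nm mx] := sup_gt neN xv.
  by apply: (iN n m) => //; rewrite (ltW mx) nx.
Qed.

(* When both ends of the interval [w < 0] lie in [D] the second alternative
   holds, with the chord of [Phi] over that interval; otherwise [w] changes sign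
   at most once on [D]. *)
Lemma convex_chord_sign (R : realType) (D : set R) (Phi w : R -> R) :
  is_interval D -> convex_function (E := R^o) D Phi ->
  is_interval [set x | w x < 0] -> open [set x | w x < 0] ->
  (exists a b : R, (a != 0) || (b != 0) /\
     forall x, D x -> 0 <= (a + b * x) * w x) \/
  (exists a b : R, forall x, D x -> 0 <= (Phi x - (a + b * x)) * w x).
Proof.
move=> iD cPhi iN oN.
have [[n [Dn wn]]|noN] := pselect (exists n, D n /\ w n < 0); last first.
  left; exists 1, 0; split; first by rewrite oner_neq0.
  move=> x Dx; rewrite mul0r addr0 mul1r leNgt.
  by apply/negP => wx; apply: noN; exists x.
(* Four cases: whether [D] has a point with [w >= 0] to the left of [n], and whether it has one to
   the right. *)
have [[l [Dl ln wl]]|noL] := pselect (exists l, [/\ D l, l < n & ~ w l < 0]);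
have [[r [Dr nr wr]]|noR] := pselect (exists r, [/\ D r, n < r & ~ w r < 0]).
- have [u [lu un uN Nu]] := open_interval_left_end iN oN wn wl ln.
  have [v [vr nv vN Nv]] := open_interval_right_end iN oN wn wr nr.
  have Du : D u by apply: (iD l n) => //; rewrite lu ltW.
  have Dv : D v by apply: (iD n r) => //; rewrite vr ltW.
  have uv : u < v := lt_trans un nv.
  (* Slope of the chord over [[u, v]]; the goal is later multiplied by [v - u] to remove this
     division. *)
  pose s := (Phi v - Phi u) / (v - u).
  have vu0 : v - u != 0 by rewrite gt_eqF// subr_gt0.
  right; exists (Phi u - s * u), s => x Dx.
  have scale : (v - u) * (Phi x - (Phi u - s * u + s * x)) =
      (v - u) * Phi x - (v - x) * Phi u - (x - u) * Phi v.
    by rewrite /s; field.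
  rewrite -(pmulr_rge0 _ (_ : 0 < v - u)) ?subr_gt0// mulrA scale.
  (* Outside [[u, v]] the extended chord lies below [Phi], by convexity at the nearer end; inside,
     it lies above. *)
  have [xu|ux] := ltP x u.
    have /negP := uN x xu; rewrite -leNgt => wx; rewrite mulr_ge0//.
    have : (v - x) * Phi u <= (v - u) * Phi x + (u - x) * Phi v.
      by apply: (convex_function_chord cPhi) => //; rewrite !ltW.
    lra.
  have [vx|xv] := ltP v x.
    have /negP := vN x vx; rewrite -leNgt => wx; rewrite mulr_ge0//.
    have : (x - u) * Phi v <= (x - v) * Phi u + (v - u) * Phi x.
      by apply: (convex_function_chord cPhi) => //; rewrite !ltW.
    lra.
  have : (v - u) * Phi x <= (v - x) * Phi u + (x - u) * Phi v.
    by apply: (convex_function_chord cPhi) => //; rewrite ux.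
  (* At [u] and [v] the facts [uN], [Nu], [vN], [Nv] give no sign of [w], but the chord meets [Phi]
     there and the product is zero. *)
  move=> H; have [ueqx|unx] := eqVneq u x.
    by subst x; nra.
  have [xeqv|xnv] := eqVneq x v; first by subst x; nra.
  have wx : w x < 0.
    have [xn|nx] := leP x n; first by apply: Nu => //; rewrite lt_neqAle unx.
    by apply: Nv; [exact: ltW|rewrite lt_neqAle xnv].
  by rewrite mulr_le0 ?(ltW wx)//; lra.
- have [u [lu un uN Nu]] := open_interval_left_end iN oN wn wl ln.
  (* On [D], [w] is non-negative to the left of [u] and negative to its right, so [u - x] matches
     its sign. The next case mirrors this with [x - v]. *)
  left; exists u, (-1); split; first by rewrite oppr_eq0 oner_neq0 orbT.
  move=> x Dx; rewrite mulN1r.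
  have [xu|] := ltP x u.
    have /negP := uN x xu; rewrite -leNgt => wx.
    by rewrite mulr_ge0// subr_ge0 ltW.
  rewrite le_eqVlt => /predU1P[<-|ux]; first by rewrite subrr mul0r.
  rewrite mulr_le0 ?subr_le0 ?(ltW ux)//; apply: ltW.
  have [xn|nx] := leP x n; first exact: Nu.
  by apply: contrapT => wx; apply: noR; exists x.
- have [v [vr nv vN Nv]] := open_interval_right_end iN oN wn wr nr.
  left; exists (- v), 1; split; first by rewrite oner_neq0 orbT.
  move=> x Dx; rewrite mul1r addrC.
  have [vx|] := ltP v x.
    have /negP := vN x vx; rewrite -leNgt => wx.
    by rewrite mulr_ge0// subr_ge0 ltW.
  rewrite le_eqVlt => /predU1P[->|xv]; first by rewrite subrr mul0r.
  rewrite mulr_le0 ?subr_le0 ?(ltW xv)//; apply: ltW.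
  have [nx|xn] := leP n x; first exact: Nv.
  by apply: contrapT => wx; apply: noL; exists x.
- left; exists (-1), 0; split; first by rewrite oppr_eq0 oner_neq0.
  move=> x Dx; rewrite mul0r addr0 mulN1r oppr_ge0; apply: ltW.
  have [xn|nx|->//] := ltgtP x n; apply: contrapT => wx.
    by apply: noL; exists x.
  by apply: noR; exists x.
Qed.

(** * Integrals against a weight orthogonal to affine functions *)

(** A non-negative integrand with integral zero vanishes almost everywhere, so almost everywhere
    [W t = 0] or [X t] is the root of the affine factor. In both cases [Phi (X t)] may be replaced
    by a constant. *)
Lemma affine_weight_Rintegral_eq0 d (T : measurableType d) (R : realType)
    (mu : {measure set T -> \bar R}) (X W : T -> R) (Phi : R -> R) (a b : R) :
  (a != 0) || (b != 0) ->
  (forall t, 0 <= (a + b * X t) * W t) ->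
  mu.-integrable setT (EFin \o W) ->
  mu.-integrable setT (EFin \o (fun t => X t * W t)) ->
  mu.-integrable setT (EFin \o (fun t => Phi (X t) * W t)) ->
  \int[mu]_t W t = 0 -> \int[mu]_t (X t * W t) = 0 ->
  \int[mu]_t (Phi (X t) * W t) = 0.
Proof.
move=> ab0 ge0 iW iXW iPW W0 XW0.
have iaW : mu.-integrable setT (EFin \o (fun t => a * W t)).
  exact: (integrableZl measurableT a iW).
have ibXW : mu.-integrable setT (EFin \o (fun t => b * (X t * W t))).
  exact: (integrableZl measurableT b iXW).
have E t : (a + b * X t) * W t = a * W t + b * (X t * W t) by ring.
have iL : mu.-integrable setT (EFin \o (fun t => (a + b * X t) * W t)).
  rewrite (_ : (fun t => _) = (fun t => a * W t + b * (X t * W t))); last first.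
    by apply/funext.
  exact: (integrableD measurableT iaW ibXW).
have L0 : \int[mu]_t ((a + b * X t) * W t) = 0.
  under eq_Rintegral do rewrite E.
  by rewrite RintegralD// !RintegralZl// W0 XW0 !mulr0 addr0.
have aeL : ae_eq mu setT (EFin \o (fun t => (a + b * X t) * W t)) (cst 0%E).
  apply/(ae_eq_integral_abs mu measurableT); first exact: measurable_int iL.
  transitivity (\int[mu]_t ((a + b * X t) * W t)%:E)%E.
    by apply: eq_integral => t _; rewrite /= ger0_norm.
  by rewrite -[LHS]fineK ?integrable_fin_num// -/(Rintegral _ _ _) L0.
(* For [b = 0] the quotient [- a / b] is 0 by convention; then [a != 0] and [W] vanishes almost
   everywhere, so any constant would do. *)
have -> : \int[mu]_t (Phi (X t) * W t) = \int[mu]_t (Phi (- a / b) * W t).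
  congr fine; apply: ae_eq_integral => //.
  - exact: measurable_int iPW.
  - exact: measurable_int (integrableZl measurableT (Phi (- a / b)) iW).
  apply: filterS aeL => t /= /(_ I)[] /eqP; rewrite mulf_eq0 => Lt _.
  congr EFin; case/orP: Lt => [/eqP abX|/eqP ->]; last by rewrite !mulr0.
  have b0 : b != 0.
    apply/eqP => b0; move: abX ab0; rewrite b0 mul0r addr0 => ->.
    by rewrite eqxx.
  suff -> : X t = - a / b by [].
  by apply: (mulfI b0); rewrite mulrCA divff// mulr1; lra.
by rewrite RintegralZl// W0 mulr0.
Qed.

Lemma convex_weighted_Rintegral_ge0 d (T : measurableType d) (R : realType)
    (mu : {measure set T -> \bar R}) (X : T -> R) (D : set R) (Phi w : R -> R) :
  is_interval D -> range X `<=` D -> convex_function (E := R^o) D Phi ->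
  is_interval [set x | w x < 0] -> open [set x | w x < 0] ->
  mu.-integrable setT (EFin \o (fun t => w (X t))) ->
  mu.-integrable setT (EFin \o (fun t => X t * w (X t))) ->
  mu.-integrable setT (EFin \o (fun t => Phi (X t) * w (X t))) ->
  \int[mu]_t w (X t) = 0 -> \int[mu]_t (X t * w (X t)) = 0 ->
  0 <= \int[mu]_t (Phi (X t) * w (X t)).
Proof.
move=> iD XD cPhi iN oN iw iXw iPw w0 Xw0.
have DX t : D (X t) by apply: XD; exists t.
have [[a [b [ab0 ge0]]]|[a [b ge0]]] := convex_chord_sign iD cPhi iN oN.
  by rewrite (affine_weight_Rintegral_eq0 ab0 _ iw iXw iPw)// => t; exact: ge0.
(* Second alternative: subtracting the affine function from [Phi] leaves the integral unchanged and
   makes the integrand non-negative. *)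
have iaw : mu.-integrable setT (EFin \o (fun t => a * w (X t))).
  exact: (integrableZl measurableT a iw).
have ibXw : mu.-integrable setT (EFin \o (fun t => b * (X t * w (X t)))).
  exact: (integrableZl measurableT b iXw).
have : 0 <= \int[mu]_t ((Phi (X t) - (a + b * X t)) * w (X t)).
  by apply: Rintegral_ge0 => t _; exact: ge0.
have E t : (Phi (X t) - (a + b * X t)) * w (X t) =
  Phi (X t) * w (X t) - (a * w (X t) + b * (X t * w (X t))) by ring.
under eq_Rintegral do rewrite E.
rewrite RintegralB//; last exact: (integrableD measurableT iaw ibXw).
by rewrite RintegralD// !RintegralZl// w0 Xw0 !mulr0 addr0 subr0.
Qed.

(** A convex function may jump at an end of [D], so the argument avoids continuity: the rays []-oo,
    c[] generate the Borel sets, and their preimages under [Phi] within [D] are intervals. *)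
Lemma measurable_convex_comp d (T : measurableType d) (R : realType)
    (X : T -> R) (D : set R) (Phi : R -> R) :
  is_interval D -> range X `<=` D -> convex_function (E := R^o) D Phi ->
  measurable_fun setT X -> measurable_fun setT (Phi \o X).
Proof.
move=> iD XD cPhi mX.
move=> mT; apply: (measurability _ (RGenInftyO.measurableE R)) => //.
move=> _ [_ [c ->] <-].
rewrite (_ : _ `&` _ = setT `&` X @^-1` [set x | D x /\ Phi x < c]).
  apply: mX => //; apply: is_interval_measurable.
  exact: is_interval_convex_sublevel iD cPhi.
apply/seteqP; split => t /=; rewrite in_itv/= => -[_].
  by move=> Pc; split => //; split => //; apply: XD; exists t.
by case.
Qed.

(** * Exponential moments and their dependence on the parameter *)

(** The bound is free of [l], so it can dominate an integrand for all parameters within [e] of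
    [a]. *)
Lemma expR_le_two_sided (R : realType) (a e l x : R) : `|l - a| <= e ->
  expR (l * x) <= expR ((a + e) * x) + expR ((a - e) * x).
Proof.
rewrite ler_distl => /andP[al la]; have [x0|x0] := leP 0 x.
  by rewrite -[leLHS]addr0 lerD ?expR_ge0// ler_expR ler_wpM2r.
by rewrite -[leLHS]add0r lerD ?expR_ge0// ler_expR ler_wnM2r// ltW.
Qed.

(** Apply [y <= expR y] at [y = e * |x|]: shifting the exponent by [e] absorbs the factor [x]. *)
Lemma normr_expR_le_two_sided (R : realType) (a e x : R) : 0 < e ->
  `|x * expR (a * x)| <= e^-1 * (expR ((a + e) * x) + expR ((a - e) * x)).
Proof.
move=> e0; rewrite -(ler_pM2l e0) mulVKf ?gt_eqF//.
rewrite normrM (ger0_norm (expR_ge0 _)).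
have le_exp (y : R) : y <= expR y.
  by rewrite (le_trans _ (expR_ge1Dx y))// lerDr.
have [x0|x0] := leP 0 x.
  rewrite -[leLHS]addr0 lerD ?expR_ge0// mulrDl expRD mulrA mulrC.
  by rewrite (ger0_norm x0) ler_wpM2l ?expR_ge0.
rewrite -[leLHS]add0r lerD ?expR_ge0// mulrBl expRD mulrA mulrC.
by rewrite (ltr0_norm x0) ler_wpM2l ?expR_ge0// mulrN.
Qed.

Lemma continuous_scaled_expR (R : realType) (k c : R) :
  continuous (fun x : R => k * expR (x * c)).
Proof.
move=> x.
apply: (@continuous_comp R R R (fun x => expR (x * c)) ( *%R k)); last first.
  exact: mulrl_continuous.
apply: (@continuous_comp R R R ( *%R^~ c) expR); last exact: continuous_expR.
exact: mulrr_continuous.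
Qed.

Section exponential_integrals.
Context d (T : measurableType d) (R : realType).
Context (mu : {measure set T -> \bar R}) (X : T -> R) (I : set R).
Hypotheses (mX : measurable_fun setT X) (oI : open I).

Let measurable_exp_tilt (a : R) : measurable_fun setT (fun t => expR (a * X t)).
Proof. by apply: measurableT_comp => //; exact: measurable_funM. Qed.

Let open_two_sided (a : R) : I a ->
  exists e : R, [/\ 0 < e, I (a + e), I (a - e) &
                    forall l, `|l - a| <= e -> I l].
Proof.
move=> Ia; have /nbhs_ballP[e /= e0 eI] : nbhs a I by exact: open_nbhs_nbhs.
(* Halving the radius puts a closed neighbourhood of [a], ends included, inside [I]. *)
have H l : `|l - a| <= e / 2 -> I l.
  move=> la; apply: eI; rewrite /ball/= distrC (le_lt_trans la)//.
  by rewrite ltr_pdivrMr// ltr_pMr// ltr1n.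
have e20 : 0 < e / 2 by rewrite divr_gt0.
exists (e / 2); split => //; apply: H.
  by rewrite addrC addKr gtr0_norm.
by rewrite addrC addKr normrN gtr0_norm.
Qed.

Lemma integrable_moment_expR :
  (forall a, I a -> mu.-integrable setT (EFin \o (fun t => expR (a * X t)))) ->
  forall a, I a ->
    mu.-integrable setT (EFin \o (fun t => X t * expR (a * X t))).
Proof.
move=> iE a /open_two_sided[e [e0 Ip Im _]].
have iD := integrableD measurableT (iE _ Ip) (iE _ Im).
apply: (le_integrable measurableT _ _ (integrableZl measurableT e^-1 iD)) => /=.
  by apply/measurable_EFinP; exact: measurable_funM.
move=> t _ /=; rewrite lee_fin.
by rewrite (le_trans (normr_expR_le_two_sided a (X t) e0))// ler_norm.
Qed.

(** Dominated convergence near [a]; the dominating function is the sum of the absolute integrands at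
    [a + e] and [a - e], both parameters in [I]. *)
Lemma continuous_Rintegral_expR (Y : T -> R) :
  (forall a, I a ->
    mu.-integrable setT (EFin \o (fun t => Y t * expR (a * X t)))) ->
  {in I, continuous (fun a : R => \int[mu]_t (Y t * expR (a * X t)))}.
Proof.
move=> iY a /set_mem /open_two_sided[e [e0 Ip Im Ie]].
have eI l : `]a - e, a + e[%classic l -> `|l - a| <= e.
  by rewrite /= in_itv/= ler_distl => /andP[? ?]; rewrite !ltW.
have iD := integrableD measurableT (integrable_abse (iY _ Ip))
                                   (integrable_abse (iY _ Im)).
apply: (@continuity_under_integral _ _ _ mu
    (fun l t => Y t * expR (l * X t)) setT measurableT (a - e) (a + e) _ _
    (fun t => `|Y t * expR ((a + e) * X t)| + `|Y t * expR ((a - e) * X t)|)).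
- by move=> l /eI /Ie /iY.
- by apply: aeW => t _ l _; exact: continuous_scaled_expR.
- by apply: eq_integrable iD => // t _.
- move=> l /eI le; apply: aeW => t _.
  rewrite !normrM !(ger0_norm (expR_ge0 _)) -mulrDr ler_wpM2l//.
  exact: expR_le_two_sided.
- by rewrite inE/= in_itv/= ltrDl gtrBl e0.
Qed.

End exponential_integrals.

(** Dividing by the positive [expR (r * x)] leaves [h x - c] with [h] a non-negative combination of
    exponentials, so the set is a strict sublevel set of a convex function. *)
Lemma expR_mixture_sublevel (R : realType) (a b c p q r : R) :
  0 <= a -> 0 <= b ->
  let w x := a * expR (p * x) + b * expR (q * x) - c * expR (r * x) in
  is_interval [set x | w x < 0] /\ open [set x | w x < 0].
Proof.
move=> a0 b0 w; split.
  pose h x := a * expR ((p - r) * x) + b * expR ((q - r) * x).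
  have wE x : w x = expR (r * x) * (h x - c).
    rewrite /w /h !mulrBl !expRD !expRN; field.
    by rewrite gt_eqF// expR_gt0.
  have ch : convex_function (E := R^o) setT h.
    have conv_exp (k s : R) (t : {i01 R}) (x y : R) : 0 <= k ->
        k * expR (s * (t%:num * x + (1 - t%:num) * y)) <=
        t%:num * (k * expR (s * x)) + (1 - t%:num) * (k * expR (s * y)).
      move=> k0; rewrite !(mulrCA _ k) -mulrDr ler_wpM2l//.
      rewrite mulrDr !(mulrCA s); exact: (@convex_expR R t (s * x) (s * y)).
    move=> t x y _ _.
    have := lerD (conv_exp a (p - r) t x y a0) (conv_exp b (q - r) t x y b0).
    rewrite addrACA -!mulrDr; exact.
  have -> : [set x | w x < 0] = [set x | [set: R] x /\ h x < c].
    apply/seteqP; split => x /=; rewrite wE pmulr_rlt0 ?expR_gt0// subr_lt0//.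
    by case.
  exact: is_interval_convex_sublevel.
apply: (@open_comp R R w [set y | y < 0]); last exact: open_lt.
move=> x _.
have ce (k s : R) : continuous (fun y : R => k * expR (s * y)).
  rewrite (_ : (fun y => _) = (fun y => k * expR (y * s))).
    exact: continuous_scaled_expR.
  by apply/funext => y; rewrite (mulrC s).
exact: (cvgB (cvgD (ce a p x) (ce b q x)) (ce c r x)).
Qed.

(** * Exponentially tilted expectations *)

(** Were the integral zero, the positive integrand would vanish almost everywhere, and a null set
    would be all of [T], which has probability one. *)
Lemma Rintegral_expR_gt0 d (T : measurableType d) (R : realType)
    (P : probability T R) (f : T -> R) :
  P.-integrable setT (EFin \o (fun t => expR (f t))) ->
  0 < \int[P]_t expR (f t).
Proof.
move=> iE; rewrite lt_neqAle Rintegral_ge0; last by move=> t _; exact: expR_ge0.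
rewrite andbT eq_sym; apply/eqP => E0.
have : ae_eq P setT (EFin \o (fun t => expR (f t))) (cst 0%E).
  apply/(ae_eq_integral_abs P measurableT); first exact: measurable_int iE.
  transitivity (\int[P]_t (expR (f t))%:E)%E.
    by apply: eq_integral => t _; rewrite /= ger0_norm ?expR_ge0.
  by rewrite -[LHS]fineK ?integrable_fin_num// -/(Rintegral _ _ _) E0.
move=> [A [mA A0 sub]].
have AT : A = setT.
  apply/seteqP; split => // t _; apply: sub => /= /(_ I) [] /eqP.
  by rewrite gt_eqF// expR_gt0.
have := probability_setT P; rewrite -AT (A0 : P A = 0%E) => /eqP.
by rewrite eq_sym onee_eq0.
Qed.

Lemma tilted_expectationE d (T : measurableType d) (R : realType)
    (P : probability T R) (X : {RV P >-> R}) (a : R) (Y : T -> R) :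
  tilted_expectation P X a Y =
  \int[P]_t (Y t * expR (a * X t)) / \int[P]_t expR (a * X t).
Proof. by rewrite /tilted_expectation unlock. Qed.

Lemma is_interval_tilted_mean d (T : measurableType d) (R : realType)
    (P : probability T R) (X : {RV P >-> R}) (I : set R) :
  is_interval I -> open I ->
  (forall a, I a -> P.-integrable setT (EFin \o (fun t => expR (a * X t)))) ->
  is_interval (tilted_mean P X @` I).
Proof.
move=> iI oI iE; apply/connected_intervalP.
apply: connected_continuous_connected; first exact/connected_intervalP.
apply: continuous_in_subspaceT => a Ia.
have mX : measurable_fun setT X by exact: measurable_funPT.
have E1 b : (fun t => 1 * expR (b * X t)) = (fun t => expR (b * X t)).
  by apply/funext => t; rewrite mul1r.
pose N (b : R) := \int[P]_t (X t * expR (b * X t)).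
(* The factor [1] makes the normaliser the case [Y = 1] of [continuous_Rintegral_expR]. *)
pose Z (b : R) := \int[P]_t (1 * expR (b * X t)).
have cN : {for a, continuous N}.
  by apply: (continuous_Rintegral_expR oI _ Ia); exact: integrable_moment_expR.
have cZ : {for a, continuous Z}.
  apply: (continuous_Rintegral_expR (Y := fun=> 1) oI _ Ia) => b Ib.
  by rewrite E1; exact: iE.
have Za : Z a != 0.
  by rewrite /Z E1 gt_eqF// Rintegral_expR_gt0//; exact/iE/set_mem.
have -> : tilted_mean P X = (fun b : R => N b * (Z b)^-1).
  by apply/funext => b; rewrite /tilted_mean tilted_expectationE /Z E1.
exact: (continuousM cN (continuousV Za cZ)).
Qed.

(** The weight absorbs the normalisers, so a combination of tilted expectations at three parameters
    becomes one integral. It is applied with [Y] equal to 1, [X] and [Phi (X)]. *)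
Lemma Rintegral_tilted_mixture d (T : measurableType d) (R : realType)
    (P : probability T R) (X : {RV P >-> R}) (Y : T -> R) (s u a b c : R) :
  P.-integrable setT (EFin \o (fun t => Y t * expR (a * X t))) ->
  P.-integrable setT (EFin \o (fun t => Y t * expR (b * X t))) ->
  P.-integrable setT (EFin \o (fun t => Y t * expR (c * X t))) ->
  let Z x := \int[P]_t expR (x * X t) in
  let W t := s / Z a * expR (a * X t) + u / Z b * expR (b * X t)
             - (Z c)^-1 * expR (c * X t) in
  P.-integrable setT (EFin \o (fun t => Y t * W t)) /\
  \int[P]_t (Y t * W t) =
    s * tilted_expectation P X a Y + u * tilted_expectation P X b Y
    - tilted_expectation P X c Y.
Proof.
move=> iYa iYb iYc Z W.
have ia := integrableZl measurableT (s / Z a) iYa.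
have ib := integrableZl measurableT (u / Z b) iYb.
have ic := integrableZl measurableT (Z c)^-1 iYc.
have iab := integrableD measurableT ia ib.
rewrite (_ : (fun t => Y t * W t) = fun t =>
    s / Z a * (Y t * expR (a * X t)) + u / Z b * (Y t * expR (b * X t))
    - (Z c)^-1 * (Y t * expR (c * X t))); last first.
  by apply/funext => t; rewrite /W mulrBr mulrDr !(mulrCA (Y t)).
split; first exact: (integrableB measurableT iab ic).
rewrite RintegralB// RintegralD// !RintegralZl// !tilted_expectationE.
rewrite -/(Z a) -/(Z b) -/(Z c) [(Z c)^-1 * _]mulrC.
by rewrite (mulrAC s) (mulrAC u) !mulrA.
Qed.

Theorem theorem2p1 (R : realType) (d : measure_display) (T : measurableType d)
    (P : probability T R) (X : {RV P >-> R}) (D : set R) (Phi : R -> R)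
    (I : set R) :
  nondegenerate_rv P X ->
  is_interval D ->
  range X `<=` D ->
  convex_function (E := R^o) D Phi ->
  is_interval I ->
  open I ->
  (forall theta : R, I theta ->
    [/\ ('E_P[fun w => expR (theta * X w)%R] < +oo)%E,
        ('E_P[fun w => (X w ^+ 2 * `|Phi (X w)| * expR (theta * X w))%R] < +oo)%E
      & ('E_P[fun w => (`|Phi (X w)| * expR (theta * X w))%R] < +oo)%E]) ->
  convex_function (E := R^o) (tilted_mean P X @` I)
    (fun rho : R =>
       tilted_expectation P X (tilted_mean_inv P X I rho) (fun w => Phi (X w))).
Proof.
move=> _ iD XD cPhi iI oI moments t x y /set_mem Jx /set_mem Jy.
have mX : measurable_fun setT X by exact: measurable_funPT.
have mE a : measurable_fun setT (fun w => expR (a * X w)).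
  by apply: measurableT_comp => //; exact: measurable_funM.
have iE a : I a -> P.-integrable setT (EFin \o (fun w => expR (a * X w))).
  move=> /moments[+ _ _]; rewrite unlock => fE.
  apply/integrableP; split; first exact/measurable_EFinP.
  by under eq_integral do rewrite /= ger0_norm ?expR_ge0//.
have iPhi a : I a ->
    P.-integrable setT (EFin \o (fun w => Phi (X w) * expR (a * X w))).
  move=> /moments[_ _ +]; rewrite unlock => fE.
  apply/integrableP; split.
    apply/measurable_EFinP; apply: measurable_funM => //.
    exact: (measurable_convex_comp iD XD cPhi mX).
  by under eq_integral do rewrite /= normrM (ger0_norm (expR_ge0 _)).
have iX := integrable_moment_expR mX oI iE.
have i1 a : I a -> P.-integrable setT (EFin \o (fun w => 1 * expR (a * X w))).
  rewrite (_ : (fun w => _) = (fun w => expR (a * X w))); first exact: iE.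
  by apply/funext => w; rewrite mul1r.
pose theta := tilted_mean_inv P X I.
(* On the image of [I], [pinv] returns a preimage that lies in [I]. *)
have thetaP z : (tilted_mean P X @` I) z ->
    I (theta z) /\ tilted_mean P X (theta z) = z.
  move=> Jz; split; last by apply: pinvK; exact: mem_set.
  apply: (surjpinv_image_sub (A := I) (f := tilted_mean P X)).
    exact: subset_refl.
  by exists z.
(* With [Y = 1] the mixture identity then reads [t + (1 - t) - 1 = 0], which is the vanishing of
   [E w(X)]. *)
have tilted1 a : I a -> tilted_expectation P X a (fun=> 1) = 1.
  move=> /iE Ia; rewrite tilted_expectationE.
  under eq_Rintegral do rewrite mul1r.
  by rewrite divff// gt_eqF// Rintegral_expR_gt0.
pose z : R := t%:num * x + (1 - t%:num) * y.
have Jz : (tilted_mean P X @` I) z.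
  have iJ := is_interval_tilted_mean iI oI iE.
  have t0 : 0 <= t%:num by [].
  have t1 : t%:num <= 1 by [].
  rewrite /z; have [xy|yx] := leP x y.
    by apply: (iJ x y) => //; apply/andP; split; nra.
  by apply: (iJ y x) => //; apply/andP; split; nra.
have [Ix rx] := thetaP x Jx; have [Iy ry] := thetaP y Jy.
have [Iz rz] := thetaP z Jz.
have mix (Y : T -> R) (iY : forall a, I a ->
    P.-integrable setT (EFin \o (fun w => Y w * expR (a * X w)))) :=
  @Rintegral_tilted_mixture _ _ _ P X Y t%:num (1 - t%:num)
    (theta x) (theta y) (theta z) (iY _ Ix) (iY _ Iy) (iY _ Iz).
have [iw Ew] := mix _ i1.
have [iXw EXw] := mix _ iX.
have [iPw EPw] := mix _ iPhi.
pose Z a := \int[P]_w expR (a * X w).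
pose a := t%:num / Z (theta x); pose b := (1 - t%:num) / Z (theta y).
pose w r := a * expR (theta x * r) + b * expR (theta y * r)
            - (Z (theta z))^-1 * expR (theta z * r).
have Z0 c : 0 <= Z c by apply: Rintegral_ge0 => r _; exact: expR_ge0.
have a0 : 0 <= a by rewrite divr_ge0.
have b0 : 0 <= b by rewrite divr_ge0 ?subr_ge0.
have [iN oN] :=
  expR_mixture_sublevel (Z (theta z))^-1 (theta x) (theta y) (theta z) a0 b0.
have E1 : (fun r => 1 * w (X r)) = (fun r => w (X r)).
  by apply/funext => r; rewrite mul1r.
rewrite -[X in P.-integrable _ (EFin \o X)]/(fun r => 1 * w (X r)) E1 in iw.
have w0 : \int[P]_r w (X r) = 0.
  rewrite -E1 [LHS]Ew !tilted1//; ring.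
have Xw0 : \int[P]_r (X r * w (X r)) = 0.
  rewrite [LHS]EXw -!/(tilted_mean P X _) rx ry rz /z; ring.
(* By [EPw] this integral is the convexity gap: the weighted values at [x] and [y] minus the value
   at [z]. *)
have := convex_weighted_Rintegral_ge0 iD XD cPhi iN oN iw iXw iPw w0 Xw0.
rewrite [X in 0 <= X]EPw subr_ge0; exact.
Qed.
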